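(* Let $f\in\mathbb{K}[x_1,\dots,x_n]$ be homogeneous of degree $d$, with slices $\{T_{i_1\dots i_{d-2}}\}_{i_1,\dots,i_{d-2}\in[n]}$ spanning the subspace $\mathcal{V}$. Then $f$ is equivalent to some polynomial in $\mathcal{P}_d$ if and only if $\mathcal{V}$ is not weakly singular, satisfies the Commutativity Property and satisfies the Diagonalisability Property.
   Context: $\mathbb{K}\in\{\mathbb{R},\mathbb{C}\}$. Slices: for $f=\sum T_{i_1\dots i_d}x_{i_1}\cdots x_{i_d}$ with $(T_{i_1\dots i_d})$ symmetric, $T_{i_1\dots i_{d-2}}$ is the matrix with $(i_{d-1},i_d)$ entry $T_{i_1\dots i_d}$. $\mathcal{P}_d$ is the set of $\sum_{i=1}^n\alpha_ix_i^d$ with all $\alpha_i\neq0$; $f$ is equivalent to $g$ if $f(x)=g(Ax)$ for some invertible $A\in M_n(\mathbb{K})$. The span $\mathcal{V}$ of the family $\{T_{i_1\dots i_{d-2}}\}$ is weakly singular if for all $\alpha=(\alpha_1,\dots,\alpha_n)\in\mathbb{K}^n$, $\det\left(\sum_{i_1,\dots,i_{d-2}\in[n]}\left(\prod_{k\in[d-2]}\alpha_{i_k}\right)T_{i_1\dots i_{d-2}}\right)=0$ (this depends on the generating family). A non-singular subspace $\mathcal{V}$ (one containing an invertible matrix) satisfies the Commutativity Property if there is an invertible $A\in\mathcal{V}$ with $A^{-1}\mathcal{V}$ a commuting subspace, and the Diagonalisability Property if there is an invertible $B\in\mathcal{V}$ such that all matrices of $B^{-1}\mathcal{V}$ are diagonalisable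 over $\mathbb{K}$. *)

(* Defs.v *)
From mathcomp Require Export all_boot all_fingroup all_algebra.
From mathcomp Require Export reals complex mpoly.

Set Implicit Arguments.
Unset Strict Implicit.
Unset Printing Implicit Defensive.

Import GRing.Theory.
Local Open Scope ring_scope.

Section Defs.
Variables (K : fieldType) (n : nat).

Definition symmetric_tensor (d : nat) (T : d.-tuple 'I_n -> K) : Prop :=
  forall (s : 'S_d) (u : d.-tuple 'I_n), T [tuple tnth u (s k) | k < d] = T u.

Definition form_of_tensor (d : nat) (T : d.-tuple 'I_n -> K) : {mpoly K[n]} :=
  \sum_(u : d.-tuple 'I_n) T u *: \prod_(k < d) 'X_(tnth u k).

(* In characteristic 0, a homogeneous polynomial of degree d has exactly one
   such tensor: see coefficient_tensor_exists and coefficient_tensor_unique. *)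
Definition coefficient_tensor (d : nat) (f : {mpoly K[n]})
    (T : d.-tuple 'I_n -> K) : Prop :=
  symmetric_tensor T /\ f = form_of_tensor T.

(* The order of the tensor is m.+2 because slices only make sense in degree at
   least 2; there are n ^ m of them, indexed by the first m indices. *)
Definition slice (m : nat) (T : m.+2.-tuple 'I_n -> K) (u : m.-tuple 'I_n) :
    'M[K]_n :=
  \matrix_(j, k) T [tuple of rcons (rcons u j) k].

Definition slice_space (m : nat) (T : m.+2.-tuple 'I_n -> K) :
    {vspace 'M[K]_n} :=
  <<[seq slice T u | u : m.-tuple 'I_n]>>%VS.

(* A property of the generating family of slices, not only of its span. *)
Definition weakly_singular (m : nat) (T : m.+2.-tuple 'I_n -> K) : Prop :=
  forall a : 'I_n -> K,
    \det (\sum_(u : m.-tuple 'I_n) (\prod_(k < m) a (tnth u k)) *: slice T u)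
      = 0.

(* A^-1 V *)
Definition inv_mul_space (A : 'M[K]_n) (V : {vspace 'M[K]_n}) :
    {vspace 'M[K]_n} :=
  (linfun (mulmx (invmx A)) @: V)%VS.

Definition commuting_space (V : {vspace 'M[K]_n}) : Prop :=
  forall M N : 'M[K]_n, M \in V -> N \in V -> comm_mx M N.

Definition commutativity_property (V : {vspace 'M[K]_n}) : Prop :=
  exists A : 'M[K]_n,
    [/\ A \in V, A \in unitmx & commuting_space (inv_mul_space A V)].

Definition diagonalisability_property (V : {vspace 'M[K]_n}) : Prop :=
  exists B : 'M[K]_n,
    [/\ B \in V, B \in unitmx
      & forall M : 'M[K]_n, M \in inv_mul_space B V -> diagonalizable M].

(* g (A x) *)
Definition linear_subst (g : {mpoly K[n]}) (A : 'M[K]_n) : {mpoly K[n]} :=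
  g \mPo [tuple \sum_(j < n) A i j *: 'X_j | i < n].

Definition equivalent (f g : {mpoly K[n]}) : Prop :=
  exists2 A : 'M[K]_n, A \in unitmx & f = linear_subst g A.

Definition in_P (d : nat) (g : {mpoly K[n]}) : Prop :=
  exists2 a : 'I_n -> K,
    forall i, a i != 0 & g = \sum_(i < n) a i *: 'X_i ^+ d.

End Defs.

Section TensorExistsUnique.
Variables (K : fieldType) (n d : nat).
Hypothesis charK0 : [pchar K] =i pred0.
Implicit Types (u v : d.-tuple 'I_n) (T : d.-tuple 'I_n -> K).

Let mon u : 'X_{1..n} := (\sum_(k < d) U_(tnth u k))%MM.

Let prod_mon u : \prod_(k < d) 'X_(tnth u k) = 'X_[mon u] :> {mpoly K[n]}.
Proof. by rewrite (big_morph _ (@mpolyXD n K) (@mpolyX0 n K)). Qed.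

Let mon_count u i : mon u i = count_mem i u.
Proof.
rewrite /mon mnm_sumE -sum1_count [RHS]big_tuple [RHS]big_mkcond /=.
by apply: eq_bigr => k _; rewrite mnm1E; case: eqP.
Qed.

Let mon_perm u v : mon u = mon v -> perm_eq u v.
Proof.
by move=> eIJ; apply/allP => i _ /=; rewrite -!mon_count eIJ.
Qed.

Let perm_mon u (s : 'S_d) : mon [tuple tnth u (s k) | k < d] = mon u.
Proof.
rewrite /mon [RHS](reindex_inj (@perm_inj _ s)) /=.
by apply: eq_bigr => k _; rewrite tnth_mktuple.
Qed.

Let num (m : 'X_{1..n}) : nat := #|[pred u | mon u == m]|.

Let num_neq0 u : (num (mon u))%:R != 0 :> K.
Proof.
have /pcharf0P -> := charK0.
by rewrite -lt0n; apply/card_gt0P; exists u; rewrite inE.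
Qed.

Let mon_surj (m : 'X_{1..n}) : mdeg m = d -> exists u, mon u = m.
Proof.
move=> dm.
pose s := flatten [seq nseq (m i) i | i <- enum 'I_n].
have count_s i : count_mem i s = m i.
  rewrite /s count_flatten -map_comp sumnE big_map big_enum /=.
  rewrite (bigD1 i) //= count_nseq /= eqxx mul1n big1 ?addn0 // => j nji.
  by rewrite count_nseq /= (negPf nji).
have size_s : size s == d.
  rewrite /s size_flatten /shape -map_comp sumnE big_map big_enum /= -dm mdegE.
  by apply/eqP; apply: eq_bigr => i _; rewrite size_nseq.
by exists (Tuple size_s); apply/mnmP => i; rewrite mon_count.
Qed.

Let coef_form T (m : 'X_{1..n}) :
  (form_of_tensor T)@_m = \sum_(u | mon u == m) T u.
Proof.
rewrite /form_of_tensor raddf_sum /= [RHS]big_mkcond /=; apply: eq_bigr => u _.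
by rewrite prod_mon mcoeffZ mcoeffX; case: eqP; rewrite ?mulr1 ?mulr0.
Qed.

Lemma coefficient_tensor_exists (f : {mpoly K[n]}) :
  f \is d.-homog -> exists T, coefficient_tensor f T.
Proof.
move=> /dhomogP hf; exists (fun u => f@_(mon u) / (num (mon u))%:R); split.
  by move=> s u; rewrite perm_mon.
apply/mpolyP => m; rewrite coef_form.
rewrite (eq_bigr (fun=> f@_m / (num m)%:R)); last by move=> u /eqP ->.
rewrite sumr_const -/(num m) -[RHS]mulr_natr.
have [mf|/memN_msupp_eq0 ->] := boolP (m \in msupp f); last by rewrite !mul0r.
by have [u <-] := mon_surj (hf m mf); rewrite divfK ?num_neq0.
Qed.

Lemma coefficient_tensor_unique (f : {mpoly K[n]}) T T' :
  coefficient_tensor f T -> coefficient_tensor f T' -> T =1 T'.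
Proof.
have key (S : d.-tuple 'I_n -> K) u : coefficient_tensor f S ->
    f@_(mon u) = S u * (num (mon u))%:R.
  case=> symS ->; rewrite coef_form (eq_bigr (fun=> S u)).
    by rewrite sumr_const mulr_natr.
  move=> v /eqP /mon_perm /tuple_permP [s eJ].
  by rewrite -(symS s u); congr S; apply: val_inj.
move=> fT fT' u; apply: (mulIf (num_neq0 u)).
by rewrite -!key.
Qed.

End TensorExistsUnique.

(* Main.v *)
Require Import Defs.

(** If f(x) = sum_i a_i (A x)_i^d, the slices are A^T D_u A with D_u diagonal,
    so all the properties can be read off A.

    Conversely, commutativity of A^-1 V passes to B^-1 V, so the matrices of
    B^-1 V are simultaneously diagonal in some basis Q.  Then
    Q^T T_u Q = S D_u with S = Q^T B Q symmetric; since S D_u is symmetric too,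
    S commutes with every D_u, hence is block diagonal along the joint
    eigenspaces, and diagonalising the form S inside each eigenspace gives an
    invertible P with all P^T T_u P diagonal.  The tensor of f(P x) then has
    diagonal slices and, being symmetric, is supported on constant indices, so
    f(P x) = sum_i a_i x_i^d.  If some a_i vanished, every matrix
    sum_u (prod_k b_(u_k)) T_u, which is congruent to
    diag(a_i (P^-1 b)_i^(d-2)), would be singular. *)

Set Implicit Arguments.
Unset Strict Implicit.
Unset Printing Implicit Defensive.
Import GRing.Theory.
Local Open Scope ring_scope.

(** * Diagonalising a symmetric matrix by block-preserving congruence *)

Section CongruenceDiagonalisation.
Variables (K : fieldType) (n : nat) (C : eqType) (c : 'I_n -> C).
Implicit Types (M N S : 'M[K]_n) (r : 'rV[K]_n).

(** The colouring [c] will record the joint eigenvalues of the [D u]; block-compatible matrices are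
    then exactly those commuting with every [D u]. *)
Definition block_compatible M := forall i j, c i != c j -> M i j = 0.

Lemma block_compatible1 : block_compatible 1%:M.
Proof. by move=> i j; rewrite mxE; case: (eqVneq i j) => [->|//]; rewrite eqxx. Qed.

Lemma block_compatibleM M N :
  block_compatible M -> block_compatible N -> block_compatible (M *m N).
Proof.
move=> cM cN i j nij; rewrite mxE big1 // => k _.
have [eik|nik] := eqVneq (c i) (c k); last by rewrite cM ?mul0r.
by rewrite (cN k j) ?mulr0 // -eik.
Qed.

Lemma block_compatible_tr M : block_compatible M -> block_compatible M^T.
Proof. by move=> cM i j nij; rewrite mxE cM // eq_sym. Qed.

(** Multiplying by it on the right adds [r 0 j] times column [a] to each column [j], so a single
    pivot clears its whole row at once. *)
Definition shear_mx (a : 'I_n) r : 'M[K]_n :=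
  \matrix_(i, j) ((i == j)%:R + (i == a)%:R * r 0 j).

Lemma mulmx_shear M a r i j : (M *m shear_mx a r) i j = M i j + M i a * r 0 j.
Proof.
rewrite mxE (eq_bigr (fun k =>
    M i k * (k == j)%:R + M i k * (k == a)%:R * r 0 j));
  last by move=> k _; rewrite mxE mulrDr mulrA.
rewrite big_split /= (bigD1 j) //= eqxx mulr1 big1 => [|k /negPf ->];
  last by rewrite mulr0.
rewrite (bigD1 a) //= eqxx mulr1 big1 ?addr0 // => k /negPf ->.
by rewrite mulr0 mul0r.
Qed.

Lemma congr_shear S a r i j :
  ((shear_mx a r)^T *m S *m shear_mx a r) i j =
  S i j + r 0 i * S a j + (S i a + r 0 i * S a a) * r 0 j.
Proof.
rewrite mulmx_shear -[S in _ *m S]trmxK -trmx_mul.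
by rewrite !(mxE _ _ i) /= !mulmx_shear !mxE ![r 0 i * _]mulrC.
Qed.

(** The part added to the identity squares to zero, so the opposite row gives the inverse. *)
Lemma shear_unit a r : r 0 a = 0 -> shear_mx a r \in unitmx.
Proof.
move=> ra0; suff /mulmx1_unit[] : shear_mx a r *m shear_mx a (- r) = 1%:M by [].
apply/matrixP => i j; rewrite mulmx_shear !mxE ra0 mulr0 addr0.
have [->|_] := eqVneq i a; last by rewrite !mul0r !addr0.
by rewrite !mul1r addrK.
Qed.

Lemma shear_block_compatible a r :
  (forall j, c a != c j -> r 0 j = 0) -> block_compatible (shear_mx a r).
Proof.
move=> cr i j nij; rewrite mxE.
have [eij|_] := eqVneq i j; first by rewrite eij eqxx in nij.
have [eia|_] := eqVneq i a; last by rewrite mul0r addr0.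
by rewrite cr ?mulr0 ?addr0 // -eia.
Qed.

Hypothesis two_neq0 : 2%:R != 0 :> K.

(* Gaussian elimination by congruence: the rows indexed by [X] are already
   cleared; a zero diagonal outside [X] is repaired by adding one basis vector
   to another, which is where characteristic 2 must be excluded. *)
Lemma congruent_diag_outside k (X : {set 'I_n}) S :
  (#|~: X| <= k)%N -> S^T = S -> block_compatible S ->
  (forall i j, i \in X -> i != j -> S i j = 0) ->
  exists Q, [/\ Q \in unitmx, block_compatible Q & is_diag_mx (Q^T *m S *m Q)].
Proof.
elim: k X S => [|k IHk] X S.
  rewrite leqn0 cards_eq0 => /eqP X0 _ _ SX.
  exists 1%:M; split; [exact: unitmx1 | exact: block_compatible1 |].
  rewrite trmx1 mul1mx mulmx1; apply/is_diag_mxP => i j nij.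
  by apply: SX => //; rewrite -[X]setCK X0 inE inE.
have comp E S1 : E \in unitmx -> block_compatible E ->
    (exists Q, [/\ Q \in unitmx, block_compatible Q &
       is_diag_mx (Q^T *m (E^T *m S1 *m E) *m Q)]) ->
    exists Q,
      [/\ Q \in unitmx, block_compatible Q & is_diag_mx (Q^T *m S1 *m Q)].
  move=> uE cE [Q [uQ cQ dQ]]; exists (E *m Q); split.
  - by rewrite unitmx_mul uE.
  - exact: block_compatibleM.
  - by rewrite trmx_mul -!mulmxA in dQ *.
have congr_sym E S1 : S1^T = S1 -> (E^T *m S1 *m E)^T = E^T *m S1 *m E.
  by move=> sS; rewrite !trmx_mul trmxK sS mulmxA.
have congr_compat E S1 : block_compatible S1 -> block_compatible E ->
    block_compatible (E^T *m S1 *m E).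
  move=> cS cE; apply: block_compatibleM => //; apply: block_compatibleM => //.
  exact: block_compatible_tr.
have pivot S1 i : (#|~: X| <= k.+1)%N -> S1^T = S1 -> block_compatible S1 ->
    (forall i j, i \in X -> i != j -> S1 i j = 0) ->
    i \notin X -> S1 i i != 0 ->
    exists Q,
      [/\ Q \in unitmx, block_compatible Q & is_diag_mx (Q^T *m S1 *m Q)].
  move=> cX sS cS SX iX Sii.
  have symS a b : S1 a b = S1 b a by rewrite -[in LHS]sS mxE.
  (* Chosen so that [r 0 j * S1 i i] cancels [S1 i j]; the value 0 at [i] keeps the shear
     invertible. *)
  pose r : 'rV[K]_n := \row_j (if j == i then 0 else - (S1 i j / S1 i i)).
  have ri : r 0 i = 0 by rewrite mxE eqxx.
  have rS j : j != i -> r 0 j * S1 i i = - S1 i j.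
    by move=> nji; rewrite mxE (negPf nji) mulNr divfK.
  have rX j : j \in X -> r 0 j = 0.
    move=> jX; rewrite mxE; case: ifP => // nji.
    by rewrite symS SX ?mul0r ?oppr0 // nji.
  have cE : block_compatible (shear_mx i r).
    apply: shear_block_compatible => j nij; rewrite mxE.
    by rewrite cS // mul0r oppr0 if_same.
  apply: (comp (shear_mx i r)) => //; first exact: shear_unit.
  apply: (IHk (i |: X)); [ | exact: congr_sym | exact: congr_compat | ].
    rewrite -ltnS; apply: leq_trans cX; apply: proper_card.
    rewrite properC setUC properE subsetUl /=.
    by apply/subsetPn; exists i; rewrite // !inE eqxx orbT.
  (* Row [i] becomes zero off the diagonal. A row [a] of [X] does not change, because [r 0 a] and
     [S1 a i] are both zero. *)
  move=> a b; rewrite in_setU1 congr_shear => /orP[/eqP->|aX] nab.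
    by rewrite ri !mul0r !addr0 mulrC rS ?subrr // eq_sym.
  rewrite (rX a aX) !mul0r !addr0 (SX a b) // add0r.
  by rewrite (SX a i) ?mul0r //; apply: contraNneq iX => <-.
move=> cX sS cS SX.
have symS a b : S a b = S b a by rewrite -[in LHS]sS mxE.
have [/existsP[i /andP[iX Sii]]|] :=
  boolP [exists i, (i \notin X) && (S i i != 0)].
  exact: (pivot S i).
rewrite negb_exists => /forallP S0.
have {}S0 i : i \notin X -> S i i = 0.
  by move=> iX; have := S0 i; rewrite iX /= negbK => /eqP.
have [/existsP[i /existsP[j /and4P[iX jX nij Sij]]]|] :=
  boolP [exists i, exists j, [&& i \notin X, j \notin X, i != j & S i j != 0]].
  (* Replacing e_i by e_i + e_j turns the zero entry at [(i, i)] into [2 * S i j], a usable pivot.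
     The shear is block compatible since [S i j != 0] forces [c i = c j]. *)
  pose r : 'rV[K]_n := delta_mx 0 i.
  have cE : block_compatible (shear_mx j r).
    apply: shear_block_compatible => l njl; rewrite mxE eqxx /=.
    have [eli|//] := eqVneq l i.
    by case/eqP: Sij; rewrite symS cS // -eli.
  apply: (comp (shear_mx j r)) => //.
    by apply: shear_unit; rewrite mxE eqxx eq_sym (negPf nij).
  apply: (pivot _ i) => //; [exact: congr_sym | exact: congr_compat | |].
    move=> a b aX nab; rewrite congr_shear !mxE eqxx /=.
    have /negPf-> : a != i by apply: contraNneq iX => <-.
    rewrite !mul0r !addr0 SX // add0r [S a j]SX ?mul0r //.
    by apply: contraNneq jX => <-.
  rewrite congr_shear !mxE !eqxx mul1r mulr1 !S0 // mul1r add0r addr0 symS.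
  by rewrite -mulr2n -mulr_natl mulf_neq0.
(* No nonzero entry is left outside [X]: [S] is already diagonal. *)
rewrite negb_exists => /forallP S1.
exists 1%:M; split; [exact: unitmx1 | exact: block_compatible1 |].
rewrite trmx1 mul1mx mulmx1; apply/is_diag_mxP => i j; rewrite val_eqE => nij.
have [iX|iX] := boolP (i \in X); first exact: SX.
have [jX|jX] := boolP (j \in X); first by rewrite symS SX // eq_sym.
have := S1 i; rewrite negb_exists => /forallP/(_ j).
by rewrite iX jX nij /= negbK => /eqP.
Qed.

Lemma congruent_diag S : S^T = S -> block_compatible S ->
  exists Q, [/\ Q \in unitmx, block_compatible Q & is_diag_mx (Q^T *m S *m Q)].
Proof.
move=> sS cS; apply: (@congruent_diag_outside _ set0) (leqnn _) _ _ _ => //.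
by move=> i j; rewrite inE.
Qed.

End CongruenceDiagonalisation.

(** * Sums and products indexed by tuples *)

Section TupleSums.
Variables (K : comNzRingType) (I : finType).

Lemma sum_tuple_prod d (F : 'I_d -> I -> K) :
  \sum_(u : d.-tuple I) \prod_(k < d) F k (tnth u k) =
  \prod_(k < d) \sum_j F k j.
Proof.
rewrite bigA_distr_bigA /=.
rewrite (reindex (fun h : {ffun 'I_d -> I} => [tuple h k | k < d])) /=.
  by apply: eq_bigr => h _; apply: eq_bigr => k _; rewrite tnth_mktuple.
exists (fun u : d.-tuple I => [ffun k => tnth u k]) => [h _|u _].
  by apply/ffunP => k; rewrite ffunE tnth_mktuple.
by apply: eq_from_tnth => k; rewrite tnth_mktuple ffunE.
Qed.

Lemma tnth_rcons_last d (u : d.-tuple I) j :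
  tnth [tuple of rcons u j] ord_max = j.
Proof. by rewrite (tnth_nth j) /= nth_rcons size_tuple ltnn eqxx. Qed.

Lemma tnth_rcons_widen d (u : d.-tuple I) j k :
  tnth [tuple of rcons u j] (widen_ord (leqnSn d) k) = tnth u k.
Proof. by rewrite !(tnth_nth j) /= nth_rcons size_tuple ltn_ord. Qed.

Lemma prod_rcons d (F : 'I_d.+1 -> I -> K) (u : d.-tuple I) j :
  \prod_(k < d.+1) F k (tnth [tuple of rcons u j] k) =
  (\prod_(k < d) F (widen_ord (leqnSn d) k) (tnth u k)) * F ord_max j.
Proof.
rewrite big_ord_recr /= tnth_rcons_last; congr (_ * _).
by apply: eq_bigr => k _; rewrite tnth_rcons_widen.
Qed.

(** Used twice in a row, this separates the two matrix indices of a slice from the indices naming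
    the slice. *)
Lemma sum_tuple_rcons d (F : d.+1.-tuple I -> K) :
  \sum_u F u = \sum_(u : d.-tuple I) \sum_j F [tuple of rcons u j].
Proof.
rewrite pair_big /=.
rewrite (reindex (fun p : d.-tuple I * I => [tuple of rcons p.1 p.2])) //=.
pose init (v : d.+1.-tuple I) := [tuple tnth v (widen_ord (leqnSn d) k) | k < d].
exists (fun v => (init v, tnth v ord_max)) => [[u j] _|v _] /=.
  rewrite tnth_rcons_last; congr (_, _); apply: eq_from_tnth => k.
  by rewrite tnth_mktuple tnth_rcons_widen.
apply: eq_from_tnth => k; case: (unliftP ord_max k) => [l ->|->];
  last by rewrite tnth_rcons_last.
have -> : lift ord_max l = widen_ord (leqnSn d) l.
  by apply: val_inj; rewrite /= /bump leqNgt ltn_ord.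
by rewrite tnth_rcons_widen tnth_mktuple.
Qed.

End TupleSums.

(** * Tensors of sums of powers, linear substitution, diagonal slices *)

Section Tensors.
Variables (K : fieldType) (n : nat).
Implicit Types (A P : 'M[K]_n) (a : 'I_n -> K).

(** The coefficient tensor of sum_i a_i (A x)_i^d: a combination of the d-th tensor powers of the
    rows of [A]. *)
Definition power_tensor d a A (u : d.-tuple 'I_n) : K :=
  \sum_i a i * \prod_(k < d) A i (tnth u k).

Lemma power_tensor_sym d a A : symmetric_tensor (@power_tensor d a A).
Proof.
move=> s u; apply: eq_bigr => i _; congr (_ * _).
rewrite [RHS](reindex_inj (@perm_inj _ s)) /=.
by apply: eq_bigr => k _; rewrite tnth_mktuple.
Qed.

Lemma form_of_power_tensor d a A :
  form_of_tensor (@power_tensor d a A) =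
  linear_subst (\sum_(i < n) a i *: 'X_i ^+ d) A.
Proof.
rewrite /form_of_tensor /linear_subst raddf_sum /=.
under eq_bigr => u _ do rewrite scaler_suml.
rewrite exchange_big /=; apply: eq_bigr => i _.
rewrite linearZ rmorphXn /= comp_mpolyXU -tnth_nth tnth_mktuple.
under eq_bigr => u _ do rewrite -scalerA -scaler_prod.
rewrite -scaler_sumr; congr (_ *: _).
by rewrite (@sum_tuple_prod _ _ d (fun _ j => A i j *: 'X_j)) prodr_const card_ord.
Qed.

Lemma slice_power_tensor m a A (u : m.-tuple 'I_n) :
  slice (@power_tensor m.+2 a A) u =
  A^T *m diag_mx (\row_i (a i * \prod_(k < m) A i (tnth u k))) *m A.
Proof.
apply/matrixP => j k; rewrite mul_mx_diag !mxE; apply: eq_bigr => i _.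
rewrite (prod_rcons (fun _ => A i)) (prod_rcons (fun _ => A i)) !mxE.
by rewrite [A i j * _]mulrC !mulrA.
Qed.

(** By distributivity the products over the slice indices collapse to (A b)_i^m. The left side is
    the matrix tested by weak singularity, a scalar multiple of which is the Hessian of the form at
    [b]. *)
Lemma polar_power_tensor m a A (b : 'I_n -> K) :
  \sum_(u : m.-tuple 'I_n)
    (\prod_(k < m) b (tnth u k)) *: slice (@power_tensor m.+2 a A) u
  = A^T *m diag_mx (\row_i (a i * (\sum_j A i j * b j) ^+ m)) *m A.
Proof.
under eq_bigr => u _ do rewrite slice_power_tensor scalemxAl scalemxAr.
rewrite -mulmx_suml -mulmx_sumr; congr (_ *m _ *m _).
apply/matrixP => i j; rewrite summxE !mxE.
under eq_bigr => u _ do rewrite !mxE mulrnAr.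
rewrite sumrMnl; congr (_ *+ _).
have -> : (\sum_j A i j * b j) ^+ m = \prod_(k < m) \sum_j A i j * b j.
  by rewrite prodr_const card_ord.
rewrite -(sum_tuple_prod (fun _ j => A i j * b j)) mulr_sumr.
by apply: eq_bigr => u _; rewrite big_split /= mulrCA [X in _ * X]mulrC.
Qed.

(** The tensor of f(P x) when [T] is that of f. *)
Definition tensor_subst d P (T : d.-tuple 'I_n -> K) (v : d.-tuple 'I_n) : K :=
  \sum_u (\prod_(k < d) P (tnth u k) (tnth v k)) * T u.

Lemma tensor_subst_sym d P (T : d.-tuple 'I_n -> K) :
  symmetric_tensor T -> symmetric_tensor (tensor_subst P T).
Proof.
move=> sT s v; rewrite /tensor_subst.
rewrite (reindex (fun u : d.-tuple 'I_n => [tuple tnth u (s k) | k < d])) /=.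
  apply: eq_bigr => u _; rewrite sT; congr (_ * _).
  rewrite [RHS](reindex_inj (@perm_inj _ s)) /=.
  by apply: eq_bigr => k _; rewrite !tnth_mktuple.
exists (fun u : d.-tuple 'I_n => [tuple tnth u (s^-1%g k) | k < d]) => u _;
  by apply: eq_from_tnth => k; rewrite !tnth_mktuple ?permKV ?permK.
Qed.

(** Exchanging the sums leaves the coefficient prod_k (P A)_(w_k, u_k) in front of [T w], which is 1
    if w = u and 0 otherwise. *)
Lemma tensor_substK d P A (T : d.-tuple 'I_n -> K) :
  P *m A = 1%:M -> tensor_subst A (tensor_subst P T) =1 T.
Proof.
move=> PA u; rewrite /tensor_subst.
under eq_bigr => v _ do rewrite mulr_sumr.
rewrite exchange_big /= (bigD1 u) //= [X in _ + X]big1 ?addr0 => [|w nwu].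
  under eq_bigr => v _ do rewrite mulrA -big_split /= .
  rewrite -mulr_suml (sum_tuple_prod (fun k j => A j (tnth u k) * P (tnth u k) j)).
  rewrite big1 ?mul1r // => k _; have /matrixP/(_ (tnth u k) (tnth u k)) := PA.
  by rewrite !mxE eqxx; apply: etrans; apply: eq_bigr => j _; rewrite mulrC.
under eq_bigr => v _ do rewrite mulrA -big_split /= .
rewrite -mulr_suml (sum_tuple_prod (fun k j => A j (tnth u k) * P (tnth w k) j)).
have [k nk] : exists k, tnth w k != tnth u k.
  apply/existsP; apply: contraNT nwu; rewrite negb_exists => /forallP e.
  by apply/eqP/eq_from_tnth => k; have := e k; rewrite negbK => /eqP.
rewrite (bigD1 k) //=; have /matrixP/(_ (tnth w k) (tnth u k)) := PA.
rewrite !mxE (negPf nk) => e; rewrite [X in X * _ * _](_ : _ = 0) ?mul0r //.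
by rewrite -[RHS]e; apply: eq_bigr => j _; rewrite mulrC.
Qed.

(** The last two indices act by congruence, the first [m] only mix the slices; a congruence
    diagonalising all slices of [T] therefore makes the new slices diagonal. *)
Lemma slice_tensor_subst m P (T : m.+2.-tuple 'I_n -> K) (v : m.-tuple 'I_n) :
  slice (tensor_subst P T) v =
  \sum_(u : m.-tuple 'I_n)
    (\prod_(k < m) P (tnth u k) (tnth v k)) *: (P^T *m slice T u *m P).
Proof.
apply/matrixP => j k; rewrite summxE mxE /tensor_subst !sum_tuple_rcons.
apply: eq_bigr => u _; rewrite -mulmxA !mxE mulr_sumr; apply: eq_bigr => i _.
rewrite !mxE mulrA mulr_sumr; apply: eq_bigr => l _.
rewrite !mxE big_ord_recr big_ord_recr /= !tnth_rcons_last.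
rewrite !tnth_rcons_widen !tnth_rcons_last.
under eq_bigr => h _ do rewrite !tnth_rcons_widen.
by rewrite -!mulrA; do 2!congr (_ * _); rewrite mulrC.
Qed.

Lemma symmetric_tensor_perm d (T : d.-tuple 'I_n -> K) (u v : d.-tuple 'I_n) :
  symmetric_tensor T -> perm_eq u v -> T u = T v.
Proof.
move=> sT /tuple_permP[s e].
by rewrite -(sT s v); congr T; apply: val_inj.
Qed.

(** Two distinct entries of [v] can be moved by symmetry to the last two places, where [T v] is an
    off-diagonal entry of a slice. *)
Lemma diag_slices_tensor m (T : m.+2.-tuple 'I_n -> K) :
  symmetric_tensor T -> (forall u, is_diag_mx (slice T u)) ->
  forall v : m.+2.-tuple 'I_n, v != [tuple tnth v ord0 | _ < m.+2] -> T v = 0.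
Proof.
move=> sT dT v nv.
have [k nk] : exists k, tnth v k != tnth v ord0.
  apply/existsP; apply: contraNT nv; rewrite negb_exists => /forallP e.
  apply/eqP/eq_from_tnth => k; rewrite tnth_mktuple.
  by have := e k; rewrite negbK => /eqP.
set y := tnth v k in nk; set x := tnth v ord0 in nk.
have pv : perm_eq v (x :: rem x v) by apply/perm_to_rem/mem_tnth.
have yrem : y \in rem x v.
  by have := mem_tnth k v; rewrite -/y (perm_mem pv) inE (negPf nk).
have su : size (rem y (rem x v)) == m.
  by rewrite size_rem // size_rem ?mem_tnth // size_tuple.
rewrite (@symmetric_tensor_perm _ _ _ [tuple of rcons (rcons (Tuple su) x) y]) //.
  have /is_diag_mxP/(_ x y) := dT (Tuple su).
  by rewrite mxE; apply; rewrite (inj_eq val_inj) eq_sym.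
apply: (perm_trans pv).
rewrite /= -!cats1 -catA perm_sym perm_catC /= perm_cons.
by rewrite perm_sym perm_to_rem.
Qed.

Lemma diag_tensor_subst m (T : m.+2.-tuple 'I_n -> K) A :
  (forall v, v != [tuple tnth v ord0 | _ < m.+2] -> T v = 0) ->
  tensor_subst A T =1 power_tensor (fun i => T [tuple i | _ < m.+2]) A.
Proof.
move=> dT u; rewrite /tensor_subst /power_tensor.
rewrite (bigID (fun v : m.+2.-tuple 'I_n =>
  v == [tuple tnth v ord0 | _ < m.+2])) /=.
rewrite [X in _ + X]big1 ?addr0 => [|v /dT->]; last by rewrite mulr0.
rewrite (reindex_onto (fun i : 'I_n => [tuple i | _ < m.+2])
  (fun v => tnth v ord0)) /=; last by move=> v /eqP <-.
apply: eq_big => [i|i _]; first by rewrite tnth_mktuple !eqxx.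
by rewrite mulrC; congr (_ * _); apply: eq_bigr => k _; rewrite tnth_mktuple.
Qed.

Lemma slice_sym m (T : m.+2.-tuple 'I_n -> K) u :
  symmetric_tensor T -> (slice T u)^T = slice T u.
Proof.
move=> sT; apply/matrixP => i j; rewrite !mxE.
apply: symmetric_tensor_perm => //=.
by rewrite -!cats1 -!catA perm_cat2l (perm_catC [:: j]).
Qed.

End Tensors.

(** * The space of slices and the two directions at tensor level *)

Section SliceSpace.
Variables (K : fieldType) (n m : nat).
Implicit Types (T : m.+2.-tuple 'I_n -> K) (A B M N : 'M[K]_n).

Lemma slice_in_space T u : slice T u \in slice_space T.
Proof. by apply: memv_span; apply: map_f; rewrite mem_enum. Qed.

Lemma slice_space_ind T (Pr : 'M[K]_n -> Prop) :
  Pr 0 -> (forall c M N, Pr M -> Pr N -> Pr (c *: M + N)) ->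
  (forall u, Pr (slice T u)) -> forall M, M \in slice_space T -> Pr M.
Proof.
move=> Pr0 PrL PrS M MV; rewrite (coord_span MV).
apply: big_ind => // [N N1 PN PN1|i _]; last first.
  rewrite -[_ *: _]addr0; apply: PrL => //.
  rewrite -tnth_nth; set N := tnth _ _.
  have /mapP[u _ ->] : N \in [seq slice T u | u : m.-tuple 'I_n].
    exact: mem_tnth.
  exact: PrS.
by rewrite -[N]scale1r; apply: PrL.
Qed.

Lemma inv_mul_spaceP A T M :
  reflect (exists2 N, N \in slice_space T & M = invmx A *m N)
          (M \in inv_mul_space A (slice_space T)).
Proof.
by apply: (iffP memv_imgP) => -[N NV ->]; exists N => //; rewrite lfunE.
Qed.

(* With C = A^-1 B in A^-1 V, the space B^-1 V is C^-1 (A^-1 V). *)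
Lemma commuting_inv_mul A B T : A \in unitmx -> B \in unitmx ->
  B \in slice_space T ->
  commuting_space (inv_mul_space A (slice_space T)) ->
  commuting_space (inv_mul_space B (slice_space T)).
Proof.
move=> uA uB BV cA; pose C := invmx A *m B.
have uC : C \in unitmx by rewrite unitmx_mul unitmx_inv uA.
have inA M : M \in slice_space T ->
    C *m (invmx B *m M) \in inv_mul_space A (slice_space T).
  by move=> MV; apply/inv_mul_spaceP; exists M; rewrite // -mulmxA mulKVmx.
have CV : C \in inv_mul_space A (slice_space T).
  by apply/inv_mul_spaceP; exists B.
have cC M : M \in slice_space T -> comm_mx C (invmx B *m M).
  move=> MV; apply: (can_inj (mulKmx uC)); rewrite [RHS]mulmxA.
  exact: (cA _ _ CV (inA M MV)).
move=> _ _ /inv_mul_spaceP[M MV ->] /inv_mul_spaceP[N NV ->].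
have := cA _ _ (inA M MV) (inA N NV); rewrite /comm_mx.
move: (cC M MV) (cC N NV); rewrite /comm_mx.
move: (invmx B *m M) (invmx B *m N) => X Y; clearbody C => cX cY.
(* From C X C Y = C Y C X, moving [C] to the left gives C C X Y = C C Y X, and [C] cancels twice. *)
rewrite -!mulmxA [X *m _]mulmxA [Y *m _]mulmxA -cX -cY -!mulmxA => e.
by rewrite -[LHS](mulKmx uC) -[C *m _](mulKmx uC) e !mulKmx.
Qed.

Lemma slice_space_sym T M :
  symmetric_tensor T -> M \in slice_space T -> M^T = M.
Proof.
move=> sT; apply: (@slice_space_ind T (fun M => M^T = M)) => [|c A B eA eB|u].
- exact: trmx0.
- by rewrite linearP /= eA eB.
- exact: slice_sym.
Qed.

Lemma codiagonal_slices T : 2%:R != 0 :> K -> symmetric_tensor T ->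
  commutativity_property (slice_space T) ->
  diagonalisability_property (slice_space T) ->
  exists2 P : 'M[K]_n, P \in unitmx &
    forall u, is_diag_mx (P^T *m slice T u *m P).
Proof.
move=> two0 sT [A [AV uA cA]] [B [BV uB dB]].
have cB := commuting_inv_mul uA uB BV cA.
have inB u : invmx B *m slice T u \in inv_mul_space B (slice_space T).
  by apply/inv_mul_spaceP; exists (slice T u) => //; apply: slice_in_space.
pose Ms := [seq invmx B *m slice T u | u : m.-tuple 'I_n].
(* Commuting diagonalisable matrices are simultaneously diagonalisable. The convention makes P M
   P^-1 diagonal, so the basis used below is [Q], the inverse of [P]. *)
have [P uP /allP dP] : codiagonalizable Ms.
  apply/codiagonalizableP; split=> [X Y|X].
    by case/mapP=> u _ -> /mapP[v _ ->]; apply: cB.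
  by case/mapP=> u _ ->; apply: dB.
pose Q := invmx P; pose S := Q^T *m B *m Q.
pose D u := P *m (invmx B *m slice T u) *m invmx P.
have dD u : is_diag_mx (D u).
  have /dP : invmx B *m slice T u \in Ms by apply: map_f; rewrite mem_enum.
  by rewrite /= /similar_to /= conjumx.
have SD u : Q^T *m slice T u *m Q = S *m D u.
  by rewrite /S /D /Q -!mulmxA mulKmx // mulKVmx.
have sS : S^T = S by rewrite !trmx_mul trmxK (slice_space_sym sT BV) mulmxA.
(* S D is symmetric, so S commutes with the diagonal matrices D u and is
   block diagonal along their joint eigenspaces. *)
have SDC u : S *m D u = D u *m S.
  have tD : (D u)^T = D u.
    apply/matrixP => i j; rewrite mxE.
    have [->//|nij] := eqVneq i j.
    by have /is_diag_mxP dDu := dD u; rewrite !dDu // val_eqE // eq_sym.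
  have : (S *m D u)^T = S *m D u.
    by rewrite -SD !trmx_mul trmxK slice_sym // mulmxA.
  by rewrite trmx_mul tD sS.
(* Indices get the same colour when they belong to the same joint eigenspace. *)
pose c i := [ffun u => D u i i].
have mulD u M i j : (M *m D u) i j = M i j * D u j j.
  rewrite mxE (bigD1 j) //= big1 ?addr0 // => k nkj.
  by have /is_diag_mxP -> := dD u; rewrite ?mulr0.
have Dmul u M i j : (D u *m M) i j = D u i i * M i j.
  rewrite mxE (bigD1 i) //= big1 ?addr0 // => k nkj.
  by have /is_diag_mxP -> := dD u; rewrite ?mul0r // eq_sym.
have cS : block_compatible c S.
  move=> i j; apply: contraNeq => Sij; apply/eqP/ffunP => u; rewrite !ffunE.
  have /matrixP/(_ i j) := SDC u; rewrite mulD Dmul mulrC => e.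
  exact/esym/(mulIf Sij).
have [O [uO cO dO]] := congruent_diag two0 sS cS.
exists (Q *m O) => [|u]; first by rewrite unitmx_mul unitmx_inv uP.
(* [O] preserves the joint eigenspaces, so [D u] can be moved past it, leaving the product of the
   diagonal matrices O^T S O and [D u]. *)
have DO : D u *m O = O *m D u.
  apply/matrixP => i j; rewrite mulD Dmul.
  have [/ffunP/(_ u)|/cO ->] := eqVneq (c i) (c j); last by rewrite mulr0 mul0r.
  by rewrite !ffunE => ->; rewrite mulrC.
have -> : (Q *m O)^T *m slice T u *m (Q *m O) = O^T *m S *m O *m D u.
  by rewrite -[RHS]mulmxA -DO [RHS]mulmxA -(mulmxA _ S) -SD trmx_mul !mulmxA.
apply/is_diag_mxP => i j nij; rewrite mulD.
by have /is_diag_mxP -> := dO; rewrite ?mul0r.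
Qed.

Lemma power_tensor_slice_space T (a : 'I_n -> K) A :
  A \in unitmx -> (forall i, a i != 0) -> T =1 power_tensor a A ->
  [/\ ~ weakly_singular T,
      commutativity_property (slice_space T) &
      diagonalisability_property (slice_space T)].
Proof.
move=> uA a0 eT.
have eS u : slice T u = slice (power_tensor a A) u.
  by apply/matrixP => i j; rewrite !mxE eT.
pose W := A^T *m diag_mx (\row_i a i) *m A.
have uW : W \in unitmx.
  rewrite !unitmx_mul unitmx_tr uA andbT /= unitmxE det_diag unitfE.
  by apply/prodf_neq0 => i _; rewrite mxE.
(* With A b = (1, ..., 1), the matrix [W] is the combination of slices given by [b]. Being
   invertible, it refutes weak singularity and is the witness for both other properties. *)
pose b j := (invmx A *m const_mx 1 : 'cV[K]_n) j 0.
have Ab i : \sum_j A i j * b j = 1.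
  have : (A *m (invmx A *m const_mx 1 : 'cV[K]_n)) i 0 = 1.
    by rewrite mulKVmx // mxE.
  by rewrite mxE.
have eW : W =
    \sum_(u : m.-tuple 'I_n) (\prod_(k < m) b (tnth u k)) *: slice T u.
  under eq_bigr => u _ do rewrite eS.
  rewrite polar_power_tensor; congr (_ *m diag_mx _ *m _).
  by apply/rowP => i; rewrite !mxE Ab expr1n mulr1.
have WV : W \in slice_space T.
  by rewrite eW; apply: memv_suml => u _; apply/memvZ/slice_in_space.
(* W^-1 V lies in the conjugate by [A] of the diagonal matrices, which gives commutativity and
   diagonalisability together. *)
have inW X : X \in inv_mul_space W (slice_space T) ->
    exists d, X = invmx A *m diag_mx d *m A.
  case/inv_mul_spaceP=> M MV ->.
  have [d ->] : exists d, M = A^T *m diag_mx d *m A.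
    move: M MV; apply: slice_space_ind => [|c M N [d ->] [d' ->]|u].
    - by exists 0; rewrite linear0 mulmx0 mul0mx.
    - exists (c *: d + d').
      by rewrite linearP /= mulmxDr mulmxDl -scalemxAr -scalemxAl.
    - by rewrite eS slice_power_tensor; eexists.
  exists (\row_i (d 0 i / a i)); apply: (can_inj (mulKmx uW)).
  rewrite mulKVmx // /W !mulmxA mulmxK //; congr (_ *m _).
  rewrite -mulmxA mulmx_diag; congr (_ *m diag_mx _).
  by apply/rowP => i; rewrite !mxE mulrC divfK.
split.
- by move/(_ b); rewrite -eW => W0; move: uW; rewrite unitmxE W0 unitr0.
- exists W; split=> // X Y /inW[d ->] /inW[d' ->].
  rewrite /comm_mx -!mulmxA !(mulmxA A) mulmxV // !mul1mx.
  by rewrite !(mulmxA (diag_mx _)) diag_mxC.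
- exists W; split=> // X /inW[d ->].
  exists A => //; apply/(similar_diagLR uA); exists d.
  by rewrite conjVmx.
Qed.

Lemma slice_space_power_tensor T : 2%:R != 0 :> K -> symmetric_tensor T ->
  ~ weakly_singular T ->
  commutativity_property (slice_space T) ->
  diagonalisability_property (slice_space T) ->
  exists a, exists2 A : 'M[K]_n, A \in unitmx &
    (forall i, a i != 0) /\ T =1 power_tensor a A.
Proof.
move=> two0 sT wsT cT dT.
have [P uP dP] := codiagonal_slices two0 sT cT dT.
pose T' := tensor_subst P T.
have dT' u : is_diag_mx (slice T' u).
  apply/is_diag_mxP => i j nij; rewrite slice_tensor_subst summxE big1 // => v _.
  by rewrite mxE; have /is_diag_mxP -> := dP v; rewrite ?mulr0.
pose a i := T' [tuple i | _ < m.+2].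
(* Substituting P^-1 back into the diagonal tensor [T'] recovers [T]. *)
have eT : T =1 power_tensor a (invmx P).
  move=> u; rewrite -(tensor_substK T (mulmxV uP)).
  exact/diag_tensor_subst/diag_slices_tensor/dT'/tensor_subst_sym.
exists a, (invmx P); rewrite ?unitmx_inv //; split=> // i.
(* A vanishing [a i] puts a zero on the diagonal factor for every [b], so all the determinants
   vanish. *)
apply/eqP => ai0; apply: wsT => b.
have eS u : slice T u = slice (power_tensor a (invmx P)) u.
  by apply/matrixP => j k; rewrite !mxE eT.
under eq_bigr => u _ do rewrite eS.
rewrite polar_power_tensor !det_mulmx det_diag (bigD1 i) //= mxE ai0.
by rewrite !mul0r mulr0 mul0r.
Qed.

End SliceSpace.

(** * From tensors back to forms *)

Lemma power_form_slices (K : fieldType) (n m : nat) (f : {mpoly K[n]})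
    (T : m.+2.-tuple 'I_n -> K) :
  [pchar K] =i pred0 -> coefficient_tensor f T ->
  (exists2 g : {mpoly K[n]}, in_P m.+2 g & equivalent f g) <->
  [/\ ~ weakly_singular T,
      commutativity_property (slice_space T) &
      diagonalisability_property (slice_space T)].
Proof.
move=> char0 fT; split=> [[_ [a a0 ->] [A uA ef]]|[wsT cT dT]].
  apply: (power_tensor_slice_space uA a0).
  (* In characteristic 0 the coefficient tensor is unique, so [T] must be the power tensor. *)
  apply: (coefficient_tensor_unique char0 fT); split.
    exact: power_tensor_sym.
  by rewrite form_of_power_tensor.
have two0 : 2%:R != 0 :> K by have /pcharf0P -> := char0.
have [a [A uA [a0 eT]]] := slice_space_power_tensor two0 fT.1 wsT cT dT.
exists (\sum_(i < n) a i *: 'X_i ^+ m.+2); first by exists a.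
exists A => //; rewrite -form_of_power_tensor fT.2.
by apply: eq_bigr => u _; rewrite eT.
Qed.

Theorem theorem3p8 (R : realType) (K : fieldType)
    (K_real_or_complex : K = R :> fieldType \/ K = R[i] :> fieldType)
    (n m : nat) (f : {mpoly K[n]}) (f_homog : f \is m.+2.-homog)
    (T : m.+2.-tuple 'I_n -> K) (f_T : coefficient_tensor f T) :
  (exists2 g : {mpoly K[n]}, in_P m.+2 g & equivalent f g) <->
  [/\ ~ weakly_singular T,
      commutativity_property (slice_space T) &
      diagonalisability_property (slice_space T)].
Proof.
apply: power_form_slices f_T.
(* Both fields are numeric, hence of characteristic 0. *)
by case: K_real_or_complex => ->; apply: Num.Theory.pchar_num.
Qed.
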